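(* For all integers $n \ge 1$ and $k \ge 0$, the number $a_{n,k}$ of intervals $S \le T$ of the Tamari lattice $\mathrm{Tam}(n)$ such that $\mathrm{des}(S) + \mathrm{asc}(T) = k$ is given by \[ a_{n,k} = \frac{2}{n(n+1)} \binom{n+1}{k+2} \binom{3n}{k}. \]
   Context: The Tamari lattice $\mathrm{Tam}(n)$ is the poset (a lattice) whose elements are the (rooted, plane) binary trees with $n$ nodes (each node has a possibly empty left subtree and a possibly empty right subtree), and whose cover relations are right rotations: $T'$ covers $T$ if $T'$ is obtained from $T$ by replacing a subtree of the form (node $j$ with left child $i$, where $i$ has subtrees $A,B$ and $j$ has right subtree $C$) by (node $i$ with left subtree $A$ and right child $j$, where $j$ has subtrees $B,C$). An interval of $\mathrm{Tam}(n)$ is a pair $(S,T)$ with $S \le T$. For a binary tree $T$, $\mathrm{des}(T)$ (resp. $\mathrm{asc}(T)$) is the number of binary trees covered by $T$ (resp. covering $T$) in the Tamari lattice. Equivalently, labelling the nodes of $T$ in inorder (recursively the left subtree, then the root, then the right subtree) and orienting the edges toward the root, $\mathrm{des}(T)$ (resp. $\mathrm{asc}(T)$) is the number of edges $i \to j$ between nodes with $i > j$ (resp. $i < j$). Binomial coefficients $\binom{a}{b}$ with $0\le a<b$ are $0$. *)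

(* Defs.v *)
From HB Require Import structures.
From mathcomp Require Import all_boot all_order all_algebra.
From mathcomp Require Import zify.

Set Implicit Arguments.
Unset Strict Implicit.
Unset Printing Implicit Defensive.

Import Order.TTheory.

Inductive bintree : Type := Leaf | Node of bintree & bintree.

Fixpoint gentree_of (t : bintree) : GenTree.tree unit :=
  if t is Node l r then GenTree.Node 0 [:: gentree_of l; gentree_of r]
  else GenTree.Leaf tt.

Fixpoint of_gentree (g : GenTree.tree unit) : bintree :=
  if g is GenTree.Node _ [:: l; r] then Node (of_gentree l) (of_gentree r)
  else Leaf.

Lemma gentree_ofK : cancel gentree_of of_gentree.
Proof. by elim=> //= l -> r ->. Qed.

HB.instance Definition _ := Countable.copy bintree (can_type gentree_ofK).

(* Only the internal nodes count: a [Leaf] is an empty subtree. *)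
Fixpoint nodes (t : bintree) : nat :=
  if t is Node l r then (nodes l + nodes r).+1 else 0.

(* [rotates t t'] iff [t'] is obtained from [t] by one right rotation, either
   at the root or inside the left or the right subtree. *)
Fixpoint rotates (t t' : bintree) : bool :=
  match t, t' with
  | Node l r, Node l' r' =>
      [|| if l is Node a b then (l' == a) && (r' == Node b r) else false,
          rotates l l' && (r' == r)
        | (l' == l) && rotates r r']
  | _, _ => false
  end.

Variant rotates_spec (l r : bintree) : bintree -> Prop :=
  | RotRoot a b of l = Node a b : rotates_spec l r (Node a (Node b r))
  | RotLeft l' of rotates l l' : rotates_spec l r (Node l' r)
  | RotRight r' of rotates r r' : rotates_spec l r (Node l r').

Lemma rotatesP l r t : rotates (Node l r) t -> rotates_spec l r t.
Proof.
case: t => //= l' r' /or3P[|/andP[h /eqP->]|/andP[/eqP-> h]].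
- by case: l => // a b /andP[/eqP-> /eqP->]; exact: RotRoot.
- exact: RotLeft.
- exact: RotRight.
Qed.

Lemma nodes_rotates t t' : rotates t t' -> nodes t' = nodes t.
Proof.
elim: t t' => // l IHl r IHr t' /rotatesP[a b ->|l' /IHl|r' /IHr] /=; lia.
Qed.

(* The sequence, in inorder, of the sizes of the right subtrees. *)
Fixpoint brackets (t : bintree) : seq nat :=
  if t is Node l r then brackets l ++ nodes r :: brackets r else [::].

Lemma size_brackets t : size (brackets t) = nodes t.
Proof. by elim: t => //= l <- r <-; rewrite size_cat /= addnS. Qed.

Lemma sumn_rotates t t' :
  rotates t t' -> sumn (brackets t) < sumn (brackets t').
Proof.
elim: t t' => // l IHl r IHr t' /rotatesP[a b ->|l' /IHl|r' h] /=.
- rewrite !sumn_cat /= !sumn_cat /=; lia.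
- rewrite !sumn_cat /=; lia.
- have := IHr _ h; rewrite !sumn_cat /= (nodes_rotates h); lia.
Qed.

Lemma all2_leq_cat (s1 s2 s3 s4 : seq nat) : size s1 = size s3 ->
  all2 leq (s1 ++ s2) (s3 ++ s4) = all2 leq s1 s3 && all2 leq s2 s4.
Proof.
by elim: s1 s3 => [|x s IHs] [|y s'] //= [/IHs->]; rewrite andbA.
Qed.

Lemma all2_leqnn (s : seq nat) : all2 leq s s.
Proof. by elim: s => //= x s ->; rewrite leqnn. Qed.

Lemma all2_leq_trans (s1 s2 s3 : seq nat) :
  all2 leq s1 s2 -> all2 leq s2 s3 -> all2 leq s1 s3.
Proof.
elim: s1 s2 s3 => [|x s IHs] [|y s'] [|z s''] //= /andP[xy ss'] /andP[yz s's''].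
by rewrite (leq_trans xy yz) (IHs _ _ ss' s's'').
Qed.

Lemma all2_leq_sumn (s1 s2 : seq nat) : all2 leq s1 s2 -> sumn s1 <= sumn s2.
Proof. by elim: s1 s2 => [|x s IHs] [|y s'] //= /andP[? /IHs ?]; lia. Qed.

Lemma brackets_rotates t t' :
  rotates t t' -> all2 leq (brackets t) (brackets t').
Proof.
elim: t t' => // l IHl r IHr t' /rotatesP[a b ->|l' h|r' h] /=.
- rewrite -catA /= all2_leq_cat // all2_leqnn /= all2_leqnn andbT; lia.
- rewrite all2_leq_cat ?size_brackets ?(nodes_rotates h) // IHl //=.
  by rewrite leqnn all2_leqnn.
- by rewrite all2_leq_cat // all2_leqnn /= IHr // (nodes_rotates h) leqnn.
Qed.

(* A rotation inside [Node a b] strictly increases a bracket other than that of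
   the root, and the latter does not change. *)
Lemma rotates_left_root a b l' x : rotates (Node a b) l' ->
  ~~ all2 leq (brackets l') (brackets a ++ x :: brackets b).
Proof.
move=> /rotatesP[a1 a2 -> | a' h | b' h] /=; apply/negP.
- rewrite -!catA /= all2_leq_cat // => /and3P[_ + _]; lia.
- rewrite all2_leq_cat ?size_brackets ?(nodes_rotates h) //.
  by move=> /andP[/all2_leq_sumn + _]; have := sumn_rotates h; lia.
- rewrite all2_leq_cat // => /and3P[_ _ /all2_leq_sumn].
  by have := sumn_rotates h; lia.
Qed.

Lemma rotates_root_left a b c l' : rotates (Node a b) l' ->
  ~~ all2 leq (brackets (Node a (Node b c))) (brackets (Node l' c)).
Proof.
move=> /rotatesP[a1 a2 ea | a' h | b' h] /=; apply/negP.
- rewrite ea /= -!catA /= -catA all2_leq_cat //= all2_leq_cat //=.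
  by move=> /and4P[_ _ _ /andP[]]; lia.
- rewrite -catA all2_leq_cat ?size_brackets ?(nodes_rotates h) //=.
  by move=> /and3P[_]; lia.
- rewrite -catA all2_leq_cat //= (nodes_rotates h) => /and3P[_]; lia.
Qed.

Lemma rotates_inj t u v : rotates t u -> rotates t v ->
  all2 leq (brackets u) (brackets v) -> u = v.
Proof.
elim: t u v => // l IHl r IHr u v.
move=> /rotatesP[a b el | l1 h1 | r1 h1] /rotatesP[a' b' el' | l2 h2 | r2 h2].
- by move: el'; rewrite el => -[-> ->].
- by rewrite el in h2; move=> h; have := rotates_root_left r h2; rewrite h.
- rewrite el /= -catA /= all2_leq_cat //= => /and3P[_ + _]; lia.
- rewrite el' in h1 *; rewrite /=.
  rewrite (_ : _ ++ _ :: _ ++ _ =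
    (brackets a' ++ (nodes b' + nodes r).+1 :: brackets b')
      ++ nodes r :: brackets r); last by rewrite -catA.
  rewrite all2_leq_cat; first by case/andP=> h; move/negP: (rotates_left_root (nodes b' + nodes r).+1 h1).
  by rewrite size_brackets (nodes_rotates h1) size_cat /= !size_brackets addnS.
- rewrite /= all2_leq_cat ?size_brackets ?(nodes_rotates h1) ?(nodes_rotates h2) //.
  by case/andP=> /(IHl _ _ h1 h2) ->.
- rewrite /= all2_leq_cat ?size_brackets ?(nodes_rotates h1) //.
  by case/andP=> /all2_leq_sumn; have := sumn_rotates h1; lia.
- rewrite el' /= -catA /= all2_leq_cat //= => /and3P[_ _].
  rewrite all2_leq_cat //= => /and3P[_ _ /all2_leq_sumn].
  by have := sumn_rotates h1; lia.
- rewrite /= all2_leq_cat ?size_brackets ?(nodes_rotates h2) //.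
  by case/and3P=> _ _ /all2_leq_sumn; have := sumn_rotates h1; lia.
- rewrite /= all2_leq_cat // => /and3P[_ _].
  by move=> /(IHr _ _ h1 h2) ->.
Qed.

Section Tamari.

Variable n : nat.

Record tamari : Type := Tamari { tree_of :> bintree; _ : nodes tree_of == n }.

HB.instance Definition _ := [isSub for tree_of].
HB.instance Definition _ := [Countable of tamari by <:].

Fixpoint trees_upto (h : nat) : seq bintree :=
  if h is h'.+1 then
    Leaf :: [seq Node l r | l <- trees_upto h', r <- trees_upto h']
  else [:: Leaf].

Lemma mem_trees_upto h t : nodes t <= h -> t \in trees_upto h.
Proof.
elim: h t => [|h IHh] [|l r] //= le_h; rewrite inE /=.
by apply/allpairsP; exists (l, r); split; rewrite ?IHh //=; lia.
Qed.

Definition tamari_enum : seq tamari := undup (pmap insub (trees_upto n)).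

Lemma tamari_enumP : Finite.axiom tamari_enum.
Proof.
apply: Finite.uniq_enumP (undup_uniq _) _ => t.
rewrite mem_undup mem_pmap_sub mem_trees_upto ?inE //.
by rewrite (eqP (valP t)).
Qed.

HB.instance Definition _ := isFinite.Build tamari tamari_enumP.

Definition tamari_rot : rel tamari := fun S T => rotates S T.

Definition tamari_le : rel tamari := connect tamari_rot.

Lemma tamari_le_brackets (S T : tamari) :
  tamari_le S T -> all2 leq (brackets S) (brackets T).
Proof.
case/connectP=> p; elim: p S => /= [S _ ->|U p IHp S /andP[SU /IHp UT] /UT].
  exact: all2_leqnn.
exact/all2_leq_trans/brackets_rotates.
Qed.

Lemma tamari_le_neq (S T : tamari) : tamari_le S T -> S != T ->
  exists2 U, tamari_rot S U & tamari_le U T.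
Proof.
case/connectP=> -[|U p] /= => [_ ->|/andP[SU Up] ->]; first by rewrite eqxx.
by move=> _; exists U => //; apply/connectP; exists p.
Qed.

Lemma tamari_le_anti : antisymmetric tamari_le.
Proof.
move=> S T /andP[ST TS]; apply/eqP/negPn/negP => /(tamari_le_neq ST)[U SU UT].
have /tamari_le_brackets/all2_leq_sumn : tamari_le U S.
  exact: connect_trans UT TS.
by have := sumn_rotates SU; lia.
Qed.

Fact tamari_display : Order.disp_t. Proof. exact: Order.Disp tt tt. Qed.

HB.instance Definition _ := Order.Le_isPOrder.Build tamari_display tamari
  (connect0 tamari_rot) tamari_le_anti (@connect_trans _ tamari_rot).

(* [T] covers [S]. *)
Definition covers (S T : tamari) : bool :=
  (S < T)%O && ~~ [exists U : tamari, (S < U < T)%O].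

Lemma coversE (S T : tamari) : covers S T = rotates S T.
Proof.
have rot_lt (U V : tamari) : rotates U V -> (U < V)%O.
  move=> UV; rewrite lt_neqAle; apply/andP; split; last exact: connect1.
  by apply/eqP => eUV; have := sumn_rotates UV; rewrite eUV ltnn.
apply/andP/idP => [[ltST noU]|ST].
  have [U SU UT] := tamari_le_neq (ltW ltST : tamari_le S T) (negbT (lt_eqF ltST)).
  have [<- //|neUT] := eqVneq U T; case/existsP: noU; exists U.
  by rewrite rot_lt // lt_neqAle neUT.
split; first exact: rot_lt.
apply/existsP => -[V /andP[ltSV ltVT]].
have [U SU UV] := tamari_le_neq (ltW ltSV : tamari_le S V) (negbT (lt_eqF ltSV)).
have ltUT : (U < T)%O by apply: le_lt_trans ltVT.
have /val_inj eUT : val U = val T.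
  exact: rotates_inj SU ST (tamari_le_brackets (ltW ltUT)).
by rewrite eUT ltxx in ltUT.
Qed.

Definition des (T : tamari) : nat := #|[set S : tamari | covers S T]|.

Definition asc (T : tamari) : nat := #|[set U : tamari | covers T U]|.

End Tamari.

(* Main.v *)
Require Import Defs.
From mathcomp Require Import all_boot all_order all_algebra.
From mathcomp Require Import zify ring.
From Stdlib Require Import Relation_Operators.

Set Implicit Arguments.
Unset Strict Implicit.
Unset Printing Implicit Defensive.

Import GRing.Theory.

(** Tamari intervals obey a decomposition with one catalytic parameter, and the
    resulting equation has an explicit algebraic solution.

    Encode a tree by its bracket vector.  The Tamari order is the componentwise
    order on these vectors ([tamari_leE]), and [des] counts the nonzero entries,
    while [des + asc] is the number of edges.  So [des S + asc T + 1] is the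
    number of nonzero entries of [S] plus the number of zero entries of [T], a
    quantity that is additive over pieces of the vectors ([weightE]).  Deleting
    the leftmost node cuts the rest of [T] into its right subtree and what lies
    above; the same cut is available in the smaller tree [S], whose own leftmost
    node covers some initial part of the first piece ([leq_hook]).  Hence an
    interval with [n+1] nodes is the same as two intervals with [n] nodes in
    total and a cut of the left spine of the lower tree of the first
    ([intervals_glued]).

    If [t] marks the weight, [z] the nodes and [u] the length of the left spine
    of [S], this gives
    [[
      (u-1) (F(u)-1) = z u F(u) ((u-1) (F(u)-1+t) + t (F(u)-F(1))).
    ]]
    Choose the series [u = U(z)] at which the derivative of this equation with
    respect to [F] vanishes.  Differentiating in [u] yields a third equation,
    and the three of them force [F(U) = U] and, with [w = U - 1],
    [[
      w = z (1+w)^3 (w+t),      t F(1) = t (1+w) - w^2 (w+t)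
    ]]
    ([catalytic_elimination]).  Lagrange inversion ([lagrange]) then gives
    [[
      n (n+1) t [z^n] F(1) = 2 [w^(n-1)] (1+w)^(3n) (t+w)^(n+1)
    ]]
    and the theorem is the coefficient of [t^(k+2)] in this identity.  All
    series are replaced by polynomials modulo a power of [z]. *)

(** * Grafting binary trees *)

(** The decomposition of trees used throughout reads the left spine from its
    lower end: the leftmost node carries a right subtree [r], and the rest of
    the tree sits above it, so that the tree is [hook r b].  On bracket vectors
    this is the removal of the first entry, and [graft] is concatenation. *)
Fixpoint graft (a b : bintree) : bintree :=
  if b is Node l r then Node (graft a l) r else a.

Definition hook (r b : bintree) : bintree := graft (Node Leaf r) b.

Fixpoint spine (t : bintree) : nat := if t is Node l _ then (spine l).+1 else 0.

Lemma brackets_graft a b : brackets (graft a b) = brackets a ++ brackets b.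
Proof. by elim: b => [|l IHl r _] /=; rewrite ?cats0 // IHl -catA. Qed.

Lemma nodes_graft a b : nodes (graft a b) = nodes a + nodes b.
Proof. by rewrite -!size_brackets brackets_graft size_cat. Qed.

Lemma spine_graft a b : spine (graft a b) = spine a + spine b.
Proof. by elim: b => [|l IHl r _] /=; rewrite ?addn0 // IHl addnS. Qed.

Lemma graftA a b c : graft a (graft b c) = graft (graft a b) c.
Proof. by elim: c => //= l -> r _. Qed.

Lemma brackets_hook r b :
  brackets (hook r b) = nodes r :: brackets r ++ brackets b.
Proof. by rewrite /hook brackets_graft. Qed.

Lemma nodes_hook r b : nodes (hook r b) = (nodes r + nodes b).+1.
Proof. by rewrite /hook nodes_graft. Qed.

Lemma spine_hook r b : spine (hook r b) = (spine b).+1.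
Proof. by rewrite /hook spine_graft. Qed.

(** Case analysis from the lower end of the left spine, in place of the
    case analysis at the root. *)
Variant hook_spec : bintree -> Type :=
  | HookLeaf : hook_spec Leaf
  | HookHook r b : hook_spec (hook r b).

Lemma hookP t : hook_spec t.
Proof.
elim: t => [|l IHl r _]; first exact: HookLeaf.
case: IHl => [|r' b]; first exact: (HookHook r Leaf).
exact: (HookHook r' (Node b r)).
Qed.

Lemma brackets_inj : injective brackets.
Proof.
move=> s t; have [m] := ubnP (nodes s); elim: m s t => // m IHm s t.
case/hookP: s => [|r b]; case/hookP: t => [|r' b'] //.
- by rewrite brackets_hook.
- by rewrite brackets_hook.
rewrite !brackets_hook nodes_hook => ltm [er /eqP].
rewrite eqseq_cat ?size_brackets // => /andP[/eqP e1 /eqP e2].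
have lt1 : nodes r < m by lia.
have lt2 : nodes b < m by lia.
by rewrite (IHm _ _ lt1 e1) (IHm _ _ lt2 e2).
Qed.

Lemma graft_inj a b a' b' : nodes a = nodes a' -> graft a b = graft a' b' ->
  a = a' /\ b = b'.
Proof.
move=> eaa /(congr1 brackets)/eqP; rewrite !brackets_graft.
rewrite eqseq_cat ?size_brackets //.
by case/andP=> /eqP/brackets_inj-> /eqP/brackets_inj->.
Qed.

Lemma hook_inj r b r' b' : hook r b = hook r' b' -> r = r' /\ b = b'.
Proof.
move=> e; have := congr1 brackets e; rewrite !brackets_hook => -[er _].
have /(graft_inj _)[] : hook r b = hook r' b' by []; first by rewrite /= er.
by case.
Qed.

(** * The Tamari order and bracket vectors *)

(** Entry [i] of a bracket vector says how far to the right the subtree of node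
    [i] extends; [fits s] says that no entry of [s] reaches beyond the end of
    [s].  A prefix that fits is one after which the tree can be cut along its
    left spine. *)
Fixpoint fits (s : seq nat) : bool :=
  if s is x :: s' then (x <= size s') && fits s' else true.

Lemma all2_leq_size (s1 s2 : seq nat) : all2 leq s1 s2 -> size s1 = size s2.
Proof. by elim: s1 s2 => [|x s IHs] [|y s'] //= /andP[_ /IHs->]. Qed.

Lemma fits_cat s1 s2 : fits s1 -> fits s2 -> fits (s1 ++ s2).
Proof.
elim: s1 => //= x s IHs /andP[lexs fs] f2.
by rewrite IHs // andbT size_cat (leq_trans lexs) // leq_addr.
Qed.

Lemma fits_catr s1 s2 : fits (s1 ++ s2) -> fits s2.
Proof. by elim: s1 => //= x s IHs /andP[_ /IHs]. Qed.

Lemma fits_leq s1 s2 : all2 leq s1 s2 -> fits s2 -> fits s1.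
Proof.
elim: s1 s2 => [|x s IHs] [|y s'] //= /andP[lexy ss'] /andP[ley fs'].
by rewrite (IHs _ ss' fs') (all2_leq_size ss') (leq_trans lexy).
Qed.

Lemma fits_brackets t : fits (brackets t).
Proof.
elim: t => //= l fl r fr; apply: fits_cat => //=.
by rewrite size_brackets leqnn.
Qed.

(** A fitting prefix of a bracket vector consists of whole blocks, one for each
    of the lowest nodes of the left spine; cutting the spine above them gives
    the two trees. *)
Lemma fits_split s s1 s2 : fits s1 -> brackets s = s1 ++ s2 ->
  exists x y, [/\ s = graft x y, brackets x = s1 & brackets y = s2].
Proof.
have [m] := ubnP (nodes s); elim: m s s1 => // m IHm s [|h s1] lem.
  by move=> _ es; exists Leaf, s; split=> //; elim: (s) => //= l <-.
case/hookP: s lem => // p q; rewrite nodes_hook brackets_hook => lem.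
case/andP=> leh fs1 [eh es]; rewrite -eh -size_brackets in leh.
have es1 : s1 = brackets p ++ drop (nodes p) s1.
  rewrite -[LHS](cat_take_drop (nodes p)); congr (_ ++ _).
  have := congr1 (take (nodes p)) es.
  rewrite -size_brackets take_size_cat // take_cat.
  by case: ltngtP leh => // -> _; rewrite subnn take0 cats0 take_size.
rewrite es1 -catA in es; move/eqP: es; rewrite eqseq_cat // eqxx /= => /eqP es.
have := fs1; rewrite es1 => /fits_catr/IHm/(_ es)[]; first lia.
move=> x [y [eq ex ey]]; exists (graft (Node Leaf p) x), y.
by split=> //; [rewrite /hook eq graftA | rewrite brackets_graft /= ex -es1 eh].
Qed.

(** The heart of the decomposition of intervals.  Since the prefix of the larger
    vector that encodes [r'] fits, so does the prefix of the same length of the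
    smaller vector: the cut of the larger tree is also a cut of the smaller
    one, and it falls above [r]. *)
Lemma leq_hook r b r' b' :
  all2 leq (brackets (hook r b)) (brackets (hook r' b')) ->
  exists y s, [/\ b = graft y s,
    all2 leq (brackets (graft r y)) (brackets r')
    & all2 leq (brackets s) (brackets b')].
Proof.
rewrite !brackets_hook /= => /andP[ler le2].
have sz : nodes r' <= size (brackets r ++ brackets b).
  by rewrite (all2_leq_size le2) size_cat size_brackets leq_addr.
move: le2; rewrite -{1}(cat_take_drop (nodes r') (_ ++ _)).
rewrite all2_leq_cat; last by rewrite size_takel // size_brackets.
case/andP=> le1 le2.
have := fits_leq le1 (fits_brackets r') => /fits_split.
move=> /(_ (graft r b) (drop (nodes r') (brackets r ++ brackets b))).
rewrite cat_take_drop brackets_graft => /(_ erefl)[x [s [eb ex es]]].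
have : brackets x = brackets r ++ drop (nodes r) (brackets x).
  rewrite -[LHS](cat_take_drop (nodes r)); congr (_ ++ _).
  by rewrite ex take_takel // -size_brackets take_size_cat.
case/(fits_split (fits_brackets r)) => r1 [y [exy /brackets_inj er1 ey]].
subst r1; rewrite exy -graftA in eb.
by exists y, s; have [_ ->] := graft_inj erefl eb; rewrite -exy ex es.
Qed.

(** The Tamari order on trees without a size index, which lets a rotation be
    carried through tree contexts. *)
Definition tle : bintree -> bintree -> Prop :=
  clos_refl_trans bintree (fun s t => rotates s t).

Lemma tle_map (f : bintree -> bintree) :
  (forall s t, rotates s t -> rotates (f s) (f t)) ->
  forall s t, tle s t -> tle (f s) (f t).
Proof.
move=> f_rot s t; elim=> [u v /f_rot|u|u v w _ uv _ vw].
- exact: rt_step.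
- exact: rt_refl.
- exact: rt_trans uv vw.
Qed.

Lemma rotates_graftl b a a' : rotates a a' -> rotates (graft a b) (graft a' b).
Proof. by move=> h; elim: b => //= l IHl r _; rewrite IHl eqxx orbT. Qed.

Lemma rotates_graftr a b b' : rotates b b' -> rotates (graft a b) (graft a b').
Proof.
elim: b b' => // l IHl r IHr b' /rotatesP[c d -> | l' h | r' h] /=.
- by rewrite !eqxx.
- by rewrite IHl // eqxx orbT.
- by rewrite h eqxx !orbT.
Qed.

(** Raising the first bracket past the whole of [v]: one rotation for each node
    on the left spine of [v]. *)
Lemma hook_graft_tle r v : tle (hook r v) (Node Leaf (graft r v)).
Proof.
elim: v => [|l IHl w _]; first exact: rt_refl.
apply: (@rt_trans _ _ _ (Node (Node Leaf (graft r l)) w)).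
  by apply: (tle_map (f := Node^~ w)) IHl => s t /= ->; rewrite eqxx orbT.
by apply: rt_step; rewrite /= !eqxx.
Qed.

(** Bracket vectors are compared in two stages: first the entry of the leftmost
    node is raised to its final value, which absorbs complete blocks of the left
    spine, then the two pieces of the cut are handled by induction. *)
Lemma leq_tle s t : all2 leq (brackets s) (brackets t) -> tle s t.
Proof.
have [m] := ubnP (nodes t); elim: m s t => // m IHm s t.
case/hookP: t => [|r' b']; case/hookP: s => [|r b].
- by move=> *; exact: rt_refl.
- by rewrite brackets_hook.
- by rewrite brackets_hook.
rewrite nodes_hook => lem /leq_hook[y [s [-> le1 le2]]].
rewrite /hook graftA.
apply: (@rt_trans _ _ _ (hook (graft r y) s)).
  by apply: (tle_map (f := graft^~ s)) (hook_graft_tle r y);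
    exact: rotates_graftl.
apply: (@rt_trans _ _ _ (hook r' s)).
  apply: (tle_map (f := hook^~ s)); last by apply: IHm le1; lia.
  by move=> u v uv; apply: rotates_graftl; rewrite /= uv.
by apply: tle_map (IHm _ _ _ le2); [exact: rotates_graftr | lia].
Qed.

Lemma tle_tamari n s t : tle s t -> forall S : tamari n, tree_of S = s ->
  exists2 T : tamari n, tree_of T = t & (S <= T)%O.
Proof.
elim=> {s t} [u v uv|u|u v w _ IH1 _ IH2] S eS.
- have nv : nodes v == n by rewrite (nodes_rotates uv) -eS (valP S).
  by exists (Tamari nv) => //; apply: connect1; rewrite /tamari_rot /= eS.
- by exists S.
- have [V eV SV] := IH1 _ eS; have [W eW VW] := IH2 _ eV.
  by exists W => //; exact: connect_trans SV VW.
Qed.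

Lemma tamari_leE n (S T : tamari n) :
  (S <= T)%O = all2 leq (brackets S) (brackets T).
Proof.
apply/idP/idP => [|/leq_tle h]; first exact: tamari_le_brackets.
by have [U /val_inj <-] := tle_tamari h erefl.
Qed.

(** * Ascents and descents *)

(** The covers of [t] are enumerated by the edges that can be rotated: [ups]
    has one entry for each left edge of [t], [downs] one for each right edge. *)
Fixpoint ups (t : bintree) : seq bintree :=
  if t is Node l r then
    (if l is Node a b then [:: Node a (Node b r)] else [::])
      ++ [seq Node l' r | l' <- ups l] ++ [seq Node l r' | r' <- ups r]
  else [::].

Fixpoint downs (t : bintree) : seq bintree :=
  if t is Node l r then
    (if r is Node b c then [:: Node (Node l b) c] else [::])
      ++ [seq Node l' r | l' <- downs l] ++ [seq Node l r' | r' <- downs r]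
  else [::].

Lemma mem_ups t t' : (t' \in ups t) = rotates t t'.
Proof.
elim: t t' => // l IHl r IHr t'; rewrite !mem_cat.
apply/idP/idP.
- case/or3P => [|/mapP[u]|/mapP[u]].
  + by case: l {IHl} => // a b; rewrite inE => /eqP->; rewrite /= !eqxx.
  + by rewrite IHl => lu ->; rewrite /= lu eqxx orbT.
  + by rewrite IHr => ru ->; rewrite /= ru eqxx !orbT.
- case/rotatesP=> [a b ->|l' h|r' h].
  + by rewrite inE eqxx.
  + by rewrite map_f ?orbT // IHl.
  + by rewrite map_f ?orbT // IHr.
Qed.

Lemma mem_downs t t' : (t' \in downs t) = rotates t' t.
Proof.
elim: t t' => [|l IHl r IHr] t'; first by rewrite in_nil; case: t'.
rewrite !mem_cat; apply/idP/idP.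
- case/or3P => [|/mapP[u]|/mapP[u]].
  + by case: r {IHr} => // a b; rewrite inE => /eqP->; rewrite /= !eqxx.
  + by rewrite IHl => lu ->; rewrite /= lu eqxx orbT.
  + by rewrite IHr => ru ->; rewrite /= ru eqxx !orbT.
- case: t' => // l0 r0 h; move e: (Node l r) h => t h.
  case/rotatesP: h e => [a b ->|l' h|r' h] [el er]; subst.
  + by rewrite inE eqxx.
  + by rewrite (map_f (Node^~ _)) ?orbT // IHl.
  + by rewrite map_f ?orbT // IHr.
Qed.

Lemma rotatesnn t : rotates t t = false.
Proof. by apply/negP => /sumn_rotates; rewrite ltnn. Qed.

Lemma ups_uniq t : uniq (ups t).
Proof.
elim: t => // l IHl r IHr /=; rewrite !cat_uniq !map_inj_uniq;
  try by move=> ? ? [].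
rewrite IHl IHr andbT; apply/and3P; split.
- by case: (l).
- apply/hasPn => u; rewrite mem_cat; case: (l) => [|a b] //; rewrite inE.
  case/orP=> /mapP[v]; rewrite mem_ups => h -> /=.
    apply/negP => /eqP[_ e]; have := congr1 nodes e => /=; lia.
  apply/negP => /eqP[e _]; have := congr1 nodes e => /=; lia.
- apply/andP; split=> //; apply/hasPn => u /mapP[v _ ->].
  by apply/mapP => -[w]; rewrite mem_ups => h [e _]; rewrite -e rotatesnn in h.
Qed.

Lemma downs_uniq t : uniq (downs t).
Proof.
elim: t => // l IHl r IHr /=; rewrite !cat_uniq !map_inj_uniq;
  try by move=> ? ? [].
rewrite IHl IHr andbT; apply/and3P; split.
- by case: (r).
- apply/hasPn => u; rewrite mem_cat; case: (r) => [|a b] //; rewrite inE.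
  case/orP=> /mapP[v]; rewrite mem_downs => h -> /=.
    apply/negP => /eqP[_ e]; have := congr1 nodes e => /=; lia.
  apply/negP => /eqP[e _]; have := congr1 nodes e => /=; lia.
- apply/andP; split=> //; apply/hasPn => u /mapP[v _ ->].
  by apply/mapP => -[w]; rewrite mem_downs => h [e _];
    rewrite -e rotatesnn in h.
Qed.

Lemma size_downs t : size (downs t) = count (ltn 0) (brackets t).
Proof.
elim: t => // l IHl r IHr /=.
by rewrite !size_cat !size_map IHl IHr count_cat /= -IHr;
  case: (r) => [|? ?] /=; lia.
Qed.

Lemma size_ups_downs t : size (ups t) + size (downs t) = (nodes t).-1.
Proof.
elim: t => // l IHl r IHr /=; rewrite !size_cat !size_map.
by case: l IHl => [|? ?]; case: r IHr => [|? ?] /=; lia.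
Qed.

Lemma card_tamari n (P : pred (tamari n)) (s : seq bintree) : uniq s ->
  (forall t, t \in s -> nodes t == n) -> (forall T : tamari n,
    (tree_of T \in s) = P T) ->
  #|[set T | P T]| = size s.
Proof.
move=> us ns sP; rewrite cardE -(size_map (@tree_of n)); apply: perm_size.
apply: uniq_perm; rewrite ?map_inj_uniq ?enum_uniq //; first exact: val_inj.
move=> t; apply/mapP/idP => [[T]|ts].
  by rewrite mem_enum inE -sP => h ->.
by exists (Tamari (ns _ ts)) => //; rewrite mem_enum inE -sP.
Qed.

Lemma ascE n (T : tamari n) : asc T = size (ups T).
Proof.
apply: card_tamari; first exact: ups_uniq.
  by move=> t; rewrite mem_ups => /nodes_rotates->; exact: (valP T).
by move=> U; rewrite mem_ups coversE.
Qed.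

Lemma desE n (T : tamari n) : des T = size (downs T).
Proof.
apply: card_tamari; first exact: downs_uniq.
  by move=> t; rewrite mem_downs => /nodes_rotates <-; exact: (valP T).
by move=> U; rewrite mem_downs coversE.
Qed.

(** The statistic in the form that is additive under grafting: on a nonempty
    interval it exceeds [des S + asc T] by one, because [asc T] is one less than
    the number of nodes of [T] with empty right subtree. *)
Definition weight (I : bintree * bintree) : nat :=
  count (ltn 0) (brackets I.1) + count (pred1 0) (brackets I.2).

Lemma weightE n (S T : tamari n) : 0 < n ->
  weight (tree_of S, tree_of T) = (des S + asc T).+1.
Proof.
move=> n_gt0; rewrite /weight desE ascE size_downs -addnS; congr (_ + _).
have := size_ups_downs T; rewrite size_downs.
have := count_predC (ltn 0) (brackets T).
rewrite size_brackets (eqP (valP T)).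
by rewrite (eq_count (a1 := predC _) (a2 := pred1 0)) => [|[]] //=; lia.
Qed.

(** * Decomposition of intervals *)

Definition trees n : seq bintree :=
  [seq t <- undup (trees_upto n) | nodes t == n].

Lemma mem_trees n t : (t \in trees n) = (nodes t == n).
Proof.
rewrite mem_filter mem_undup; case: eqP => //= <-.
exact: mem_trees_upto.
Qed.

Definition is_interval (I : bintree * bintree) : bool :=
  all2 leq (brackets I.1) (brackets I.2).

Definition intervals n : seq (bintree * bintree) :=
  [seq I <- [seq (s, t) | s <- trees n, t <- trees n] | is_interval I].

Lemma interval_nodes I : is_interval I -> nodes I.1 = nodes I.2.
Proof. by move/all2_leq_size; rewrite !size_brackets. Qed.

Lemma mem_intervals n I : (I \in intervals n) =
  is_interval I && (nodes I.2 == n).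
Proof.
case: I => s t; rewrite mem_filter; case lest: (is_interval _) => //=.
have /= est := interval_nodes lest.
apply/allpairsP/eqP => [[[s' t'] [/= _ h [_ ->]]]|h].
  by move: h; rewrite mem_trees => /eqP.
by exists (s, t); rewrite /= !mem_trees est h eqxx.
Qed.

Lemma intervals_uniq n : uniq (intervals n).
Proof.
have u : uniq (trees n) by rewrite filter_uniq ?undup_uniq.
by apply: filter_uniq; apply: allpairs_uniq => // -[? ?] [? ?] _ _.
Qed.

Lemma card_intervals n k : 0 < n ->
  #|[set I : tamari n * tamari n |
      (I.1 <= I.2)%O && (des I.1 + asc I.2 == k)]|
  = count (fun I => weight I == k.+1) (intervals n).
Proof.
move=> n_gt0; rewrite -size_filter cardE.
pose f (I : tamari n * tamari n) := (tree_of I.1, tree_of I.2).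
have f_inj : injective f by move=> [S T] [S' T'] [/val_inj-> /val_inj->].
rewrite -(size_map f); apply: perm_size.
apply: uniq_perm; first by rewrite map_inj_uniq ?enum_uniq.
  exact/filter_uniq/intervals_uniq.
move=> [s t]; rewrite mem_filter mem_intervals; apply/mapP/idP.
  case=> [[S T]]; rewrite mem_enum inE tamari_leE /= => /andP[le_ST ek] [-> ->].
  by rewrite weightE // (eqP ek) eqxx /is_interval le_ST /=; exact: (valP T).
case/and3P=> /eqP ew lest ht; have /= hs := interval_nodes lest.
have hs' : nodes s == n by rewrite hs.
exists (Tamari hs', Tamari ht) => //; rewrite mem_enum inE tamari_leE /=.
by rewrite -eqSS -weightE //= ew eqxx andbT.
Qed.

Fixpoint splits (s : bintree) : seq (bintree * bintree) :=
  (s, Leaf) ::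
    if s is Node l r then [seq (xy.1, Node xy.2 r) | xy <- splits l] else [::].

Lemma mem_splits s xy : (xy \in splits s) = (graft xy.1 xy.2 == s).
Proof.
elim: s xy => [|l IHl r _] [x y] /=.
  by rewrite inE; case: y => [|a b] /=; rewrite xpair_eqE ?andbT // andbF.
rewrite inE xpair_eqE; case: y => [|a b] /=.
  by rewrite andbT; case: (x == _) => //; apply/negP => /mapP[[u v] _ []].
rewrite andbF /=; apply/mapP/eqP => [[[u v]]|[ea ->]].
  by rewrite IHl /= => /eqP <- [-> -> ->].
by exists (x, a) => //; rewrite IHl ea /=.
Qed.

Lemma splits_uniq s : uniq (splits s).
Proof.
elim: s => //= l IHl r _; rewrite map_inj_uniq ?IHl ?andbT.
  by apply/mapP => -[].
by move=> [? ?] [? ?] [-> ->].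
Qed.

(** An interval with [n.+1] nodes is built from a pair [d] of intervals with [n]
    nodes in total, and a cut [xy] of the lower tree of the first: the leftmost
    node of the upper tree receives the whole upper tree of [d.1] as right
    subtree, that of the lower tree receives only the part [xy.1]. *)
Definition glue (d : (bintree * bintree) * (bintree * bintree))
    (xy : bintree * bintree) : bintree * bintree :=
  (hook xy.1 (graft xy.2 d.2.1), hook d.1.2 d.2.2).

Definition interval_pairs n : seq ((bintree * bintree) * (bintree * bintree)) :=
  [seq d | i <- iota 0 n.+1,
           d <- [seq (p, q) | p <- intervals i, q <- intervals (n - i)]].

Definition glued_intervals n :=
  [seq glue d xy | d <- interval_pairs n, xy <- splits d.1.1].

Lemma mem_interval_pairs n d : (d \in interval_pairs n) =
  [&& is_interval d.1, is_interval d.2 & nodes d.1.2 + nodes d.2.2 == n].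
Proof.
apply/allpairsPdep/idP => [[i [d' [hi hd ->]]]|].
  move: hi hd; rewrite mem_iota => hi /allpairsP[[p q] [/=]].
  by rewrite !mem_intervals => /andP[lp /eqP ep] /andP[lq /eqP eq] -> /=;
    rewrite lp lq ep eq /=; lia.
case: d => p q /and3P[/= lp lq /eqP en]; exists (nodes p.2), (p, q); split=> //.
  by rewrite -[_ :: _]/(iota 0 n.+1) mem_iota leq0n add0n ltnS -en leq_addr.
apply/allpairsP; exists (p, q); rewrite /= !mem_intervals lp lq eqxx /=.
by split=> //; rewrite -en addKn.
Qed.

Lemma interval_pairs_uniq n : uniq (interval_pairs n).
Proof.
apply: allpairs_uniq_dep; first exact: iota_uniq.
  move=> i _; apply: allpairs_uniq; try exact: intervals_uniq.
  by move=> [? ?] [? ?] _ _.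
move=> [i d] [j d'] hi hj /= e; subst d'.
have mem u : u \in [seq @Tagged _ i0 (fun=> _) d0 | i0 <- iota 0 n.+1,
  d0 <- [seq (p, q) | p <- intervals i0, q <- intervals (n - i0)]] ->
    nodes (tagged u).1.2 = tag u.
  case/allpairsPdep=> [k [d1 [_ /allpairsP[[p q] [/= + _ ->]] ->]]] /=.
  by rewrite mem_intervals => /andP[_ /eqP].
by have /= := mem _ hi; have /= := mem _ hj => -> ->.
Qed.

Lemma glued_intervals_uniq n : uniq (glued_intervals n).
Proof.
apply: allpairs_uniq_dep; first exact: interval_pairs_uniq.
  by move=> d _; exact: splits_uniq.
have mem u : u \in [seq @Tagged _ i0 (fun=> _) d0 | i0 <- interval_pairs n,
  d0 <- splits i0.1.1] ->
    is_interval (tag u).1 /\ graft (tagged u).1 (tagged u).2 = (tag u).1.1.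
  case/allpairsPdep=> [k [d1 [+ + ->]]] /=.
  by rewrite mem_interval_pairs mem_splits => /and3P[-> _ _] /eqP.
move=> u u' /mem hu /mem hu'; case: u u' hu hu'.
move=> [[p1 p2] [q1 q2]] [x y] [[[p1' p2'] [q1' q2']] [x' y']] /=.
case=> /interval_nodes /= np ep [/interval_nodes /= np' ep'].
case=> /hook_inj[ex exy] /hook_inj[e2 e4]; subst x' p2' q2' p1 p1'.
rewrite !nodes_graft in np np'.
by have [|-> ->] := graft_inj _ exy; first lia.
Qed.

(** Every interval arises from exactly one such gluing; existence is
    [leq_hook], and uniqueness holds because grafting is injective once sizes
    are known. *)
Lemma intervals_glued n : perm_eq (intervals n.+1) (glued_intervals n).
Proof.
apply: uniq_perm; rewrite ?intervals_uniq ?glued_intervals_uniq // => -[s t].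
rewrite mem_intervals; apply/andP/allpairsPdep => [[/= lst nt]|].
  case/hookP: t lst nt => // r' b'; rewrite nodes_hook eqSS => + nt.
  case/hookP: s => [|r b]; first by rewrite /is_interval /= brackets_hook.
  case/leq_hook=> y [s [-> le1 le2]].
  (* The first interval is read off the node after [y] has been grafted back
     onto [r], so that its lower tree has as many nodes as [r']. *)
  exists ((graft r y, r'), (s, b')), (r, y); split=> //.
    by rewrite mem_interval_pairs /is_interval /= le1 le2.
  by rewrite mem_splits.
case=> [[[p1 p2] [q1 q2]] [[x y] []]]; rewrite mem_interval_pairs mem_splits /=.
case/and3P=> lp lq /eqP nq /eqP exy [-> ->]; subst p1.
have /= np := interval_nodes lp; rewrite nodes_graft in np.
rewrite nodes_hook nq eqxx; split=> //.
rewrite /is_interval /= !brackets_hook /= -np leq_addr /=.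
rewrite brackets_graft catA -brackets_graft all2_leq_cat.
  by apply/andP; split.
by rewrite !size_brackets nodes_graft.
Qed.

Local Open Scope ring_scope.

(** * Generating polynomials of the intervals *)

Section Generating.
Variables (K : idomainType) (t : K).

(** The exponent of ['X], the length of the left spine of the lower tree, is a
    catalytic parameter: it counts the possible cuts in the next gluing and has
    to be recorded for the recurrence to close, though only the value at [1] is
    wanted in the end. *)
Definition gf n : {poly K} :=
  \sum_(I <- intervals n) t ^+ weight I *: 'X^(spine I.1).

Lemma gf0 : gf 0 = 1.
Proof.
by rewrite /gf (_ : intervals 0 = [:: (Leaf, Leaf)]) // big_seq1 scale1r.
Qed.

(** Cutting a left spine of length [l] leaves a part of each length from [0] to
    [l], which makes a geometric sum; the factor [t] is missing from the one
    cut whose lower part is empty. *)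
Lemma splits_sum s :
  ('X - 1) * (\sum_(xy <- splits s) t ^+ (0 < nodes xy.1)%N *: 'X^(spine xy.2))
  = t%:P * ('X^(spine s) - 1) + ('X - 1) * 'X^(spine s) :> {poly K}.
Proof.
elim: s => [|l IHl r _] /=; first by rewrite big_seq1 /= scale1r; ring.
rewrite big_cons big_map /= expr1 expr0.
rewrite (_ : \sum_(_ <- _) _ =
  'X * \sum_(xy <- splits l) t ^+ (0 < nodes xy.1)%N *: 'X^(spine xy.2)).
  by rewrite mulrDr mulrCA IHl -mul_polyC exprS; ring.
by rewrite mulr_sumr; apply: eq_bigr => xy _; rewrite exprS -scalerAr.
Qed.

Lemma weight_glue d xy : graft xy.1 xy.2 = d.1.1 ->
  weight (glue d xy) =
    ((0 < nodes xy.1) + (nodes d.1.2 == 0) + weight d.1 + weight d.2)%N.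
Proof.
case: d xy => [[p1 p2] [q1 q2]] [x y] /= <-.
rewrite /weight !brackets_hook /= !brackets_graft !count_cat /=; lia.
Qed.

Lemma spine_glue d xy : spine (glue d xy).1 = (spine xy.2 + spine d.2.1).+1.
Proof. by rewrite spine_hook spine_graft. Qed.

(** The contribution to [gf n.+1] of the new node together with the first
    interval of the pair. *)
Definition first_part i : {poly K} :=
  \sum_(p <- intervals i) \sum_(xy <- splits p.1)
    t ^+ ((0 < nodes xy.1) + (nodes p.2 == 0) + weight p)%N *: 'X^(spine xy.2).

(** The correction at [i = 0] comes from the empty first interval, for which
    both leftmost nodes have an empty right subtree. *)
Lemma first_partE i :
  ('X - 1) * first_part i = ('X - 1) * (gf i - ((i == 0)%:R * (1 - t))%:P)
    + t%:P * (gf i - (gf i).[1]%:P).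
Proof.
case: i => [|i].
  rewrite gf0 /first_part (_ : intervals 0 = [:: (Leaf, Leaf)]) // !big_seq1 /=.
  by rewrite /weight /= hornerC mul1r expr1 expr0 -mul_polyC polyCB; ring.
rewrite mul0r subr0 /gf horner_sum raddf_sum /= -sumrB !mulr_sumr -big_split /=.
rewrite !big_seq; apply: eq_bigr => p.
rewrite mem_intervals => /andP[_ /eqP ->].
rewrite !hornerE expr1n mulr1.
rewrite (_ : \sum_(xy <- splits p.1) _ =
  t ^+ weight p *:
    \sum_(xy <- splits p.1) t ^+ (0 < nodes xy.1)%N *: 'X^(spine xy.2)).
  rewrite -scalerAr splits_sum -!mul_polyC; ring.
by rewrite scaler_sumr; apply: eq_bigr => xy _;
  rewrite scalerA -exprD addn0 addnC.
Qed.

Lemma gf_rec n : gf n.+1 = 'X * \sum_(i < n.+1) first_part i * gf (n - i)%N.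
Proof.
rewrite [LHS](perm_big _ (intervals_glued n)) big_allpairs_dep big_allpairs_dep.
rewrite -[iota 0 _]/(index_iota 0 n.+1) big_mkord mulr_sumr;
  apply: eq_bigr => i _.
rewrite big_allpairs /= mulr_suml mulr_sumr; apply: eq_bigr => p _.
rewrite exchange_big /= mulr_suml mulr_sumr.
transitivity (\sum_(xy <- splits p.1) \sum_(q <- intervals (n - i)%N)
  t ^+ weight (glue (p, q) xy) *: 'X^(spine (glue (p, q) xy).1) : {poly K}).
  by [].
rewrite !big_seq; apply: eq_bigr => xy; rewrite mem_splits => /eqP exy.
rewrite mulr_sumr mulr_sumr; apply: eq_bigr => q _.
rewrite weight_glue // spine_glue /= -!mul_polyC exprS !exprD !polyCM; ring.
Qed.

End Generating.

(** * Polynomials modulo a power of the variable *)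

Section Truncation.

Variables (K : idomainType).

(** Membership in the ideal generated by ['X^N].  Power series identities are
    proved for polynomials modulo such an ideal, with [N] larger than the
    index of the coefficient of interest. *)
Definition small N (p : {poly K}) := exists q, p = 'X^N * q.

Lemma smallP N p : small N p <-> forall i, (i < N)%N -> p`_i = 0.
Proof.
split=> [[q ->] i lt|h]; first by rewrite coefXnM lt.
exists (drop_poly N p); rewrite mulrC -[LHS](poly_take_drop N).
suff -> : take_poly N p = 0 by rewrite add0r.
by apply/polyP => i; rewrite coef_take_poly coef0; case: ifP => // /h.
Qed.

Lemma smallD N (p q : {poly K}) : small N p -> small N q -> small N (p + q).
Proof. by move=> [a ->] [b ->]; exists (a + b); ring. Qed.

Lemma smallM N (p q : {poly K}) : small N p -> small N (q * p).
Proof. by move=> [a ->]; exists (q * a); ring. Qed.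

Lemma smallXB N (p q : {poly K}) m : small N (p - q) ->
  small N (p ^+ m - q ^+ m).
Proof. by move=> h; rewrite subrXX mulrC; exact: smallM. Qed.

(** A polynomial with nonzero constant term is not a zero divisor modulo
    ['X^N], although it need not be invertible there. *)
Lemma small_cancel N (p q : {poly K}) : p`_0 != 0 -> small N (p * q) ->
  small N q.
Proof.
move=> p0 /smallP h; apply/smallP; elim/ltn_ind => i IHi ltiN.
have := h _ ltiN; rewrite coefM big_ord_recl /= subn0.
rewrite big1 ?addr0 => [/eqP|j _].
  by rewrite mulf_eq0 (negPf p0) => /eqP.
by rewrite IHi ?mulr0 // /bump /=; [have := ltn_ord j; lia | lia].
Qed.

(** The map [U |-> 1 + 'X * P.[U]] is a contraction for the ['X]-adic topology,
    since [U - V] divides [P.[U] - P.[V]]; iterating it [N] times reaches a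
    fixed point modulo ['X^N]. *)
Lemma small_fixpoint (P : {poly {poly K}}) N :
  exists U, small N (U - (1 + 'X * P.[U])).
Proof.
elim: N => [|N [U [q qE]]]; first by exists 0, (0 - (1 + 'X * P.[0])); ring.
exists (1 + 'X * P.[U]).
have [d dE] : exists d : {poly K},
    P.[U] - P.[1 + 'X * P.[U]] = d * (U - (1 + 'X * P.[U])).
  set V := 1 + _; have /factor_theorem[Q QE] : root (P - P.[V]%:P) V.
    by rewrite /root !hornerE subrr.
  by exists Q.[U]; have := congr1 (horner^~ U) QE; rewrite !hornerE.
exists (d * q); rewrite [RHS](_ : _ = 'X * (d * ('X^N * q))).
  by rewrite -qE -dE; ring.
by rewrite exprS; ring.
Qed.

(** Lagrange inversion: if [w] solves [w = z psi(w)] modulo [z^N], then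
    [n [z^n] f(w) = [x^n] x f'(x) psi(x)^n].  It is enough to treat [f = x^m].
    There [w^m = z^m psi^m(w)] reduces coefficient [n] of [w^m] to coefficient
    [n - m] of [psi^m(w)], known by induction for the smaller index [n - m], and
    both sides match because [n (psi^m)' psi^(n-m) = m (psi^n)']. *)
Lemma lagrange (psi w : {poly K}) N (f : {poly K}) n :
  (forall m, (0 < m)%N -> m%:R != 0 :> K) ->
  small N (w - 'X * (psi \Po w)) -> (n < N)%N ->
  (f \Po w)`_n *+ n = ('X * f^`() * psi ^+ n)`_n.
Proof.
move=> char0 wE; elim/ltn_ind: n f => n IHn f ltnN.
suff mono m : ('X^m \Po w)`_n *+ n = ('X * ('X^m)^`() * psi ^+ n)`_n.
  rewrite -[f in LHS]coefK -[f in RHS]coefK poly_def !linear_sum /=.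
  rewrite mulr_sumr mulr_suml !coef_sum -sumrMnl; apply: eq_bigr => i _.
  by rewrite !linearZ /= -scalerAr -scalerAl !coefZ -mulrnAr mono.
case: m => [|m].
  by rewrite expr0 derivC mulr0 mul0r coef0 comp_polyC coef1;
    case: (n) => // n'; rewrite mul0rn.
rewrite derivXn /= mulrnAr -exprS mulrnAl coefMn comp_Xn_poly.
have -> : (w ^+ m.+1)`_n = ('X^(m.+1) * (psi ^+ m.+1 \Po w))`_n.
  apply/eqP; rewrite -subr_eq0 -coefB; apply/eqP.
  apply: (proj1 (smallP N _)) ltnN.
  by rewrite rmorphXn /= -exprMn; exact: smallXB.
rewrite !coefXnM; case: ltngtP => [_|ltmn|<-]; first by rewrite !mul0rn.
- set j := (n - m.+1)%N; have j_gt0 : (0 < j)%N by rewrite /j; lia.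
  have eqn : n = (j + m).+1 by rewrite /j; lia.
  have ltjn : (j < n)%N by rewrite eqn; lia.
  have nz : j%:R != 0 :> K by apply: char0.
  apply: (mulIf nz); rewrite !mulr_natr mulrnAC.
  rewrite (IHn _ ltjn _ (ltn_trans ltjn ltnN)) -[LHS]coefMn.
  rewrite (_ : 'X * (psi ^+ m.+1)^`() * psi ^+ j *+ n =
    ('X * (psi ^+ n)^`()) *+ m.+1).
    by rewrite coefMn coefXM -[in LHS](prednK j_gt0) /= coef_deriv prednK //
      mulrnAC.
  rewrite !deriv_exp eqn /= exprD; ring.
- have w0 : w`_0 = 0.
    have /eqP := proj1 (smallP N _) wE 0 (leq_ltn_trans (leq0n _) ltnN).
    by rewrite coefB coefXM subr0 => /eqP.
  by rewrite subnn -!horner_coef0 horner_comp [w.[0]]horner_coef0 w0.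
Qed.

Lemma small_eq N (p q : {poly K}) : small N p -> q = p -> small N q.
Proof. by move=> h ->. Qed.

End Truncation.

(** * The catalytic equation *)

Section Catalytic.

Variables (R : comNzRingType) (z t f1 : R).

(** The series [F = sum_n gf_n(u) z^n], where [u] is the polynomial variable,
    makes this expression vanish when [f1] is the value of [F] at [u = 1]. *)
Definition catalytic (F : {poly R}) : {poly R} :=
  ('X - 1) * (F - 1)
  - 'X * z%:P * F * (('X - 1) * (F - (1 - t)%:P) + t%:P * (F - f1%:P)).

(** The partial derivative of [catalytic] with respect to [F], with [F] treated
    as an independent variable, is [u - 1 - z * kernel F]. *)
Definition kernel (F : {poly R}) : {poly R} :=
  'X * ((F *+ 2 - (1 - t)%:P) * ('X - 1) + t%:P * (F *+ 2 - f1%:P)).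

Lemma horner_kernel F u : (kernel F).[u] =
  u * ((F.[u] *+ 2 - (1 - t)) * (u - 1) + t * (F.[u] *+ 2 - f1)).
Proof. by rewrite !hornerE /=; ring. Qed.

Lemma horner_catalytic F u : (catalytic F).[u] = (u - 1) * (F.[u] - 1)
  - u * z * F.[u] * ((u - 1) * (F.[u] - (1 - t)) + t * (F.[u] - f1)).
Proof. by rewrite !hornerE /=; ring. Qed.

(** The chain rule, arranged so that the coefficient of [F^`()] is the partial
    derivative that the choice of [u] makes vanish. *)
Lemma horner_deriv_catalytic F u : (catalytic F)^`().[u] = F.[u] - 1
  - z * F.[u] * ((u - 1) * (F.[u] - (1 - t)) + t * (F.[u] - f1))
  - u * z * F.[u] * (F.[u] - (1 - t))
  + F^`().[u] * (u - 1 - z * (kernel F).[u]).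
Proof.
rewrite horner_kernel.
rewrite !(derivD, derivN, derivM, derivX, derivC) !hornerE /=; ring.
Qed.

End Catalytic.

Section Elimination.

Variables (K : idomainType) (t : K).
Hypothesis t_neq0 : t != 0.
Hypothesis char0 : forall m, (0 < m)%N -> m%:R != 0 :> K.

(** The series through which the solution is parametrized satisfies
    [w = z psi(w)]. *)
Definition psi : {poly K} := (1 + 'X) ^+ 3 * ('X + t%:P).

Lemma psi_comp w : psi \Po w = (1 + w) ^+ 3 * (w + t%:P).
Proof.
by rewrite /psi comp_polyM rmorphXn /= !comp_polyD !comp_polyX !comp_polyC.
Qed.

(** Substituting for [u] the series [U] at which the derivative of the equation
    in [F] vanishes makes its derivative in [u] vanish as well.  With
    [w = U - 1] and [a = F(U) - 1], the three equations combine into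
    [w = (1+w) z (1+a)^2 (w+t)] and [a = (1+w)^2 z (1+a) (a+t)].  Cross
    multiplication turns these into [(w - a) (t + w a + t (w + a)) = 0], whose
    second factor has constant term [t], so that [w = a].  What remains is
    [w = z psi(w)] and an expression of [t f1] as a polynomial in [w], up to
    the factor [w]. *)
Lemma catalytic_elimination N F f1 G : (1 < N)%N ->
  catalytic 'X t%:P f1 F = 'X^N%:P * G ->
  exists2 w : {poly K}, small N (w - 'X * (psi \Po w)) &
    small N (w * (t%:P * f1 - (t%:P * (1 + w) - w ^+ 2 * (w + t%:P)))).
Proof.
move=> N_gt1 FE; pose T := t%:P; pose z : {poly K} := 'X.
(* [B'] is the value at [U] of the derivative of [F] in [u]; subtracting
   [B'] times [UE] from the differentiated equation removes it. *)
have [U UE] := small_fixpoint (kernel T f1 F) N.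
pose B := F.[U]; pose B' := F^`().[U]; pose w := U - 1; pose a := B - 1.
pose g b := w * (b + T) + T * (1 + b - f1).
have s0 : small N (w - (1 + w) * z * (g a + (1 + a) * (w + T))).
  by apply: small_eq UE _; rewrite horner_kernel -/B /g /a /w /z /T; ring.
have s1 : small N (w * a - (1 + w) * z * (1 + a) * g a).
  exists G.[U]; have := congr1 (horner^~ U) FE.
  rewrite horner_catalytic hornerM hornerC => <-.
  by rewrite -/B /g /a /w /z /T; ring.
have s2 : small N (a - z * (1 + a) * g a - (1 + w) * z * (1 + a) * (a + T)).
  have s2' : small N (catalytic 'X t%:P f1 F)^`().[U].
    by exists (G^`().[U]); rewrite FE derivM derivC mul0r add0r hornerM hornerC.
  apply: small_eq (smallD s2' (smallM (- B') UE)) _.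
  by rewrite horner_deriv_catalytic -/B -/B' /g /a /w /z /T; ring.
have i1 : small N (w - (1 + w) * z * (1 + a) ^+ 2 * (w + T)).
  apply: small_eq (smallD (smallM (1 + a) s0) (smallM (- 1) s1)) _.
  by rewrite /g; ring.
have i2 : small N (a - (1 + w) ^+ 2 * z * (1 + a) * (a + T)).
  by apply: small_eq (smallD (smallM (1 + w) s2) (smallM (- 1) s1)) _; ring.
have w0 : w`_0 = 0.
  have /eqP := proj1 (smallP N _) i1 0 (ltnW N_gt1).
  rewrite coefB (_ : _ * (w + T) = z * ((1 + w) * (1 + a) ^+ 2 * (w + T))).
    by rewrite coefXM subr0 => /eqP.
  by ring.
have a0 : a`_0 = 0.
  have /eqP := proj1 (smallP N _) i2 0 (ltnW N_gt1).
  rewrite coefB (_ : _ * (a + T) = z * ((1 + w) ^+ 2 * (1 + a) * (a + T))).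
    by rewrite coefXM subr0 => /eqP.
  by ring.
have wa : small N (a - w).
  apply: (@small_cancel K N (T + w * a + T * (w + a))).
    rewrite !coefD coefCM coefD !coefM !big_ord1 /= coefC /= w0 a0.
    by rewrite !(mulr0, addr0).
  apply: small_eq (smallD (smallM (- (1 + w) * (a + T)) i1)
                          (smallM ((1 + a) * (w + T)) i2)) _.
  by ring.
have wE : small N (w - z * ((1 + w) ^+ 3 * (w + T))).
  apply: small_eq
    (smallD i1 (smallM ((1 + w) * z * (w + T) * (a + w + 2%:R)) wa)) _.
  by ring.
exists w; first by rewrite psi_comp.
have s1' : small N (w ^+ 2 - (1 + w) ^+ 2 * z * g w).
  apply: small_eq
    (smallD s1 (smallM ((1 + w) * z * (g a + (1 + w) * (w + T)) - w) wa)) _.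
  by rewrite /g; ring.
apply: small_eq (smallD (smallM ((1 + w) * (w + T)) s1') (smallM (- g w) wE)) _.
by rewrite /g /T; ring.
Qed.

(** Cancelling a series of valuation one costs one order of precision. *)
Lemma small_cancelX N (w q : {poly K}) : w`_0 = 0 -> w`_1 != 0 ->
  small N.+1 (w * q) -> small N q.
Proof.
move=> w0 w1 /smallP h; apply: (@small_cancel _ N (drop_poly 1 w)).
  by rewrite coef_drop_poly.
apply/smallP => i ltiN; have := h i.+1 ltiN.
rewrite -[w in w * q](poly_take_drop 1) mulrDl mulrAC coefD coefMXn /=.
rewrite subn1 (_ : take_poly 1 w = 0) ?mul0r ?coef0 ?add0r //.
by apply/polyP => -[|j]; rewrite coef_take_poly coef0.
Qed.

(** Lagrange inversion applied to [t f1 = f(w)], where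
    [f(x) = t (1+x) - x^2 (x+t)].  The coefficient it produces simplifies since
    [(n+2) f' psi^(n+1) - 2 (x+t) psi^(n+1)] equals [n H - x H'] for the
    polynomial [H] below, and the coefficient of [x^n] in [n H - x H'] is zero
    for any [H]. *)
Lemma catalytic_coef N F f1 G n :
  catalytic 'X t%:P f1 F = 'X^N%:P * G -> (n.+2 < N)%N ->
  t * f1`_n.+1 *+ (n.+1 * n.+2) =
    ((1 + 'X) ^+ (3 * n.+1) * ('X + t%:P) ^+ n.+2)`_n *+ 2.
Proof.
case: N => // N FE ltnN.
have N_gt1 : (1 < N.+1)%N := ltn_trans (isT : 1 < n.+2)%N ltnN.
have [w wE f1E] := catalytic_elimination N_gt1 FE.
have w0 : w`_0 = 0.
  have /eqP := proj1 (smallP _ _) wE 0 isT.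
  by rewrite coefB coefXM subr0 => /eqP.
have w1 : w`_1 = t.
  have /eqP := proj1 (smallP _ _) wE 1 N_gt1.
  rewrite coefB coefXM /= subr_eq0 => /eqP ->.
  rewrite -horner_coef0 horner_comp [w.[0]]horner_coef0 w0 /psi !hornerE /=.
  by ring.
pose f := t%:P * (1 + 'X) - 'X ^+ 2 * ('X + t%:P).
have fw : t * f1`_n.+1 = (f \Po w)`_n.+1.
  rewrite -coefCM; apply/eqP; rewrite -subr_eq0 -coefB; apply/eqP.
  have lt' : (n.+1 < N)%N by [].
  apply: (proj1 (smallP N _)) lt'; apply: (small_cancelX w0);
    first by rewrite w1.
  apply: small_eq f1E _; congr (_ * (_ - _)).
  by rewrite /f !(comp_polyB, comp_polyD, comp_polyM, comp_polyC, comp_polyX,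
    comp_Xn_poly).
rewrite fw mulrnA (lagrange _ char0 wE) //; last by rewrite ltnW.
rewrite -mulrA coefXM /= -!coefMn.
(* [H] is chosen so that [n H - x H'] has a common factor [psi^(n+1)] with the
   polynomial produced by Lagrange inversion. *)
pose H := psi ^+ n.+1 * ((1 + 'X) * ('X + t%:P)).
have HE : (H *+ n - 'X * H^`())`_n = 0.
  rewrite coefB coefMn coefXM; case: (n) => [|m]; first by rewrite mulr0n subr0.
  by rewrite coef_deriv subrr.
apply/eqP; rewrite -subr_eq0 -coefB.
rewrite (_ : _ - _ = H *+ n - 'X * H^`()) ?HE //.
have -> : (1 + 'X) ^+ (3 * n.+1) * ('X + t%:P) ^+ n.+2 =
  psi ^+ n.+1 * ('X + t%:P).
  by rewrite exprM [('X + _) ^+ n.+2]exprSr mulrA -exprMn.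
rewrite /H /f derivM deriv_exp [psi ^+ n.+1]exprS /=.
move: (psi ^+ n) => q; rewrite /psi.
rewrite !(derivM, deriv_exp, derivD, derivB, derivN, derivC, derivX,
  derivXn) /=.
ring.
Qed.

End Elimination.

(** * Counting the intervals *)

Section Coefficients.

Variables (K : idomainType) (t : K).

(** The recurrence [gf_rec], summed against powers of [z] up to order [N].  The
    sum is first written with [z] as outer variable, where coefficients can be
    compared, and then [swapXY] makes [u] the outer variable, in which the
    equation has to be evaluated and differentiated. *)
Lemma catalytic_gf N : exists F G,
    catalytic 'X t%:P (\poly_(n < N) (gf t n).[1]) F = 'X^N%:P * G.
Proof.
pose Fz := \poly_(n < N) gf t n; pose f1 := \poly_(n < N) (gf t n).[1].
pose M : {poly {poly K}} :=
  ('X - 1)%:P * (Fz - (1 - t)%:P%:P) + t%:P%:P * (Fz - f1 ^:P).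
have MP i : (i < N)%N -> M`_i = ('X - 1) * first_part t i.
  move=> ltiN; rewrite first_partE !coefD !coefCM !coefB coef_map /=.
  rewrite !coef_poly ltiN coefC; congr (_ * (_ - _) + _).
  by case: eqP; rewrite ?mul1r ?mul0r.
have [G GE] : small N (('X - 1)%:P * (Fz - 1) - 'X%:P * 'X * Fz * M).
  apply/smallP => -[|n] ltnN.
    rewrite !(coefD, coefB, coefN, coefCM) coef_poly ltnN gf0 coef1 subrr mulr0.
    by rewrite -!mulrA coefCM coefXM mulr0 subr0.
  rewrite coefB !coefCM coefB coef_poly ltnN coef1 subr0
    -!mulrA coefCM coefXM /=.
  rewrite gf_rec mulrCA [Fz * M]mulrC coefM mulr_sumr -mulrBr
    -sumrB big1 ?mulr0 //.
  move=> i _; have lti := ltn_ord i.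
  by rewrite MP 1?coef_poly ?ifT ?mulrA ?subrr //; lia.
exists (swapXY Fz), (swapXY G).
have := congr1 (fun p => swapXY p) GE.
rewrite !(rmorphM, rmorphB, rmorphD, rmorph1, rmorphXn) /=.
rewrite !swapXY_polyC swapXY_X.
rewrite swapXY_map_polyC map_polyX !map_polyC /= => <-.
by rewrite /catalytic !polyCB.
Qed.

Lemma gf_eval1 n : (gf t n).[1] = \sum_(I <- intervals n) t ^+ weight I.
Proof.
by rewrite horner_sum; apply: eq_bigr => I _; rewrite !hornerE expr1n mulr1.
Qed.

Hypothesis t_neq0 : t != 0.
Hypothesis char0 : forall m, (0 < m)%N -> m%:R != 0 :> K.

Lemma gf_coef n :
  t * (gf t n.+1).[1] *+ (n.+1 * n.+2) =
    ((1 + 'X) ^+ (3 * n.+1) * ('X + t%:P) ^+ n.+2)`_n *+ 2.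
Proof.
have [F [G FE]] := catalytic_gf n.+3.
by rewrite -(catalytic_coef t_neq0 char0 FE) // coef_poly ifT.
Qed.

End Coefficients.

Lemma coef_XaddC_exp (R : comNzRingType) (c : R) b j :
  (('X + c%:P) ^+ b)`_j = c ^+ (b - j) *+ 'C(b, j).
Proof.
rewrite addrC exprDn coef_sum; have [lejb|ltbj] := leqP j b.
  rewrite (bigD1 (Ordinal (lejb : (j < b.+1)%N))) //= big1 ?addr0 => [|i neij].
    by rewrite -polyC_exp coefMn coefCM coefXn eqxx mulr1.
  rewrite -polyC_exp coefMn coefCM coefXn; case: eqP => [e|]; last by
    rewrite mulr0 mul0rn.
  by case/eqP: neij; apply: val_inj.
rewrite bin_small // mulr0n big1 // => i _.
rewrite -polyC_exp coefMn coefCM coefXn; case: eqP => [e|]; last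
  by rewrite mulr0 mul0rn.
by have := ltn_ord i; lia.
Qed.

(** Taking the indeterminate [t] of [{poly rat}] as weight, the number of
    intervals is the coefficient of [t^(k+1)] in [gf n.+1] at [u = 1]. On the
    right only the product of the coefficients of [x^k] and [x^(n-k)] of the two
    factors contributes to [t^(k+2)]. *)
Lemma count_intervals n k :
  (count (fun I => weight I == k.+1) (intervals n.+1) * (n.+1 * n.+2) =
    2 * ('C(n.+2, k.+2) * 'C(3 * n.+1, k)))%N.
Proof.
have char0 m : (0 < m)%N -> m%:R != 0 :> {poly rat}.
  by rewrite -polyC_natr polyC_eq0 Num.Theory.pnatr_eq0; lia.
have := gf_coef (negbT (polyX_eq0 rat)) char0 n.
move/(congr1 (fun p : {poly rat} => p`_k.+2)).
rewrite !coefMn coefXM /= gf_eval1 coef_sum.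
rewrite (eq_bigr (fun I => (weight I == k.+1)%:R)) => [|I _]; last
  by rewrite coefXn eq_sym.
rewrite -natr_sum (_ : \sum_(I <- _) _ =
  count (fun I => weight I == k.+1) (intervals n.+1))%N; last first.
  by rewrite -sum1_count [RHS]big_mkcond; apply: eq_bigr => I _; case: eqP.
rewrite -mulrnA coefM coef_sum => e.
apply/eqP; rewrite -(Num.Theory.eqr_nat rat) {}e.
rewrite (eq_bigr (fun i : 'I_n.+1 =>
  (k == i)%:R * ('C(3 * n.+1, i) * 'C(n.+2, n - i))%:R)); last first.
  move=> i _; have lti := ltn_ord i.
  rewrite [1 + 'X]addrC -[1]/(1%:P) !coef_XaddC_exp.
  rewrite expr1n ['C(_, _)%:R * _]mulr_natl -mulrnA coefMn coefXn.
  rewrite (_ : n.+2 - (n - i) = i.+2)%N; last by lia.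
  by rewrite !eqSS mulr_natr mulnC.
have [lekn|ltnk] := leqP k n.
  rewrite (bigD1 (Ordinal (lekn : (k < n.+1)%N))) //= big1 ?addr0 => [|i neik].
    by rewrite eqxx mul1r -mulrnA -(@bin_sub n.+2 k.+2) // !subSS mulnC
      [('C(n.+2, _) * _)%N]mulnC.
  case: eqP => [e|]; last by rewrite mul0r.
  by case/eqP: neik; apply: val_inj.
rewrite big1 => [|i _]; first by rewrite bin_small // mul0n muln0 mul0rn.
by case: eqP => [ek|_]; [have := ltn_ord i; lia | rewrite mul0r].
Qed.

Theorem theorem1 (n k : nat) (n_ge1 : (1 <= n)%N) :
  #|[set I : tamari n * tamari n |
      (I.1 <= I.2)%O && (des I.1 + asc I.2 == k)%N]|%:R =
    2 / (n * (n + 1))%:R * 'C(n + 1, k + 2)%:R * 'C(3 * n, k)%:R :> rat.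
Proof.
case: n n_ge1 => // n _; rewrite card_intervals // addn1 addn2.
have nz : (n.+1 * n.+2)%:R != 0 :> rat by rewrite Num.Theory.pnatr_eq0.
apply: (mulIf nz); rewrite -natrM count_intervals natrM
  [('C(_, _) * _)%:R]natrM.
by move: nz; set d : rat := (n.+1 * n.+2)%:R; move: d => d d_neq0; field.
Qed.
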